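(* A cooperative interval game $(N,w)$ has a nonempty strong core if and only if $w(N)$ is a degenerate interval (i.e. $\underline{w}(N)=\overline{w}(N)$) and the upper border game $(N,\overline{w})$ has a nonempty core.
   Context: Let $N=\{1,2,\ldots,n\}$ be a set of players, $2^N$ its power set, and $\mathbb{IR}$ the set of all closed real intervals $X=[\underline{X},\overline{X}]$. A (classical) cooperative game is a pair $(N,v)$ with $v:2^N\to\mathbb{R}$ and $v(\emptyset)=0$. A cooperative interval game is a pair $(N,w)$ with $w:2^N\to\mathbb{IR}$ and $w(\emptyset)=[0,0]$; write $\underline{w}(S)$, $\overline{w}(S)$ for the lower and upper bound of $w(S)$. The upper border game is the cooperative game $(N,\overline{w})$. A selection of $(N,w)$ is a cooperative game $(N,v)$ with $v(S)\in w(S)$ for every $S\in 2^N$. For a cooperative game $v$, the imputation set is $I(v)=\{x\in\mathbb{R}^N: \sum_{i\in N}x_i=v(N),\ x_i\ge v(\{i\})\ \forall i\in N\}$ and the core is $C(v)=\{x\in I(v): \sum_{i\in S}x_i\ge v(S)\ \forall S\subseteq N\}$. The strong core of $(N,w)$ is the set of vectors $x\in\mathbb{R}^N$ such that $x$ is an element of the core of every selection of $(N,w)$. *)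

(* Defs.v *)
From HB Require Import structures.
From mathcomp Require Import all_boot all_order all_algebra.
From mathcomp Require Import classical_sets reals.

Set Implicit Arguments.
Unset Strict Implicit.
Unset Printing Implicit Defensive.

Import Order.TTheory GRing.Theory Num.Theory.
Local Open Scope ring_scope.

(* The player set {1, ..., n} is 'I_n, coalitions are finite sets
   S : {set 'I_n}, and payoff vectors in R^N are finite functions.  The names
   finset.set0 and finset.setT are qualified because classical_sets has
   homonyms; solution concepts are classical sets of payoff vectors. *)

Record closed_itv (R : realType) := ClosedItv {
  lower : R;
  upper : R;
  lower_le_upper : lower <= upper
}.

Definition itv_of (R : realType) (X : closed_itv R) : interval R :=
  `[lower X, upper X].

Definition degenerate (R : realType) (X : closed_itv R) : Prop :=
  lower X = upper X.

Definition point_itv (R : realType) (a : R) : closed_itv R :=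
  ClosedItv (lexx a).

Record game (R : realType) (n : nat) := Game {
  value :> {set 'I_n} -> R;
  value_empty : value finset.set0 = 0
}.

Record interval_game (R : realType) (n : nat) := IntervalGame {
  ivalue :> {set 'I_n} -> closed_itv R;
  ivalue_empty : ivalue finset.set0 = point_itv 0
}.

Lemma upper_empty (R : realType) (n : nat) (w : interval_game R n) :
  upper (w finset.set0) = 0.
Proof. by rewrite ivalue_empty. Qed.

Definition upper_border (R : realType) (n : nat) (w : interval_game R n) :
    game R n :=
  @Game R n (fun S => upper (w S)) (upper_empty w).

Definition selection (R : realType) (n : nat) (w : interval_game R n)
    (v : game R n) : Prop :=
  forall S : {set 'I_n}, v S \in itv_of (w S).

Definition imputation (R : realType) (n : nat) (v : game R n) :
    set {ffun 'I_n -> R} :=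
  fun x => \sum_(i : 'I_n) x i = v finset.setT /\
           forall i : 'I_n, v (finset.set1 i) <= x i.

Definition core (R : realType) (n : nat) (v : game R n) :
    set {ffun 'I_n -> R} :=
  fun x => imputation v x /\
           forall S : {set 'I_n}, v S <= \sum_(i in S) x i.

Definition strong_core (R : realType) (n : nat) (w : interval_game R n) :
    set {ffun 'I_n -> R} :=
  fun x => forall v : game R n, selection w v -> core v x.

(* Main.v *)
Require Import Defs.
From mathcomp Require Import all_boot all_order all_algebra.
From mathcomp Require Import classical_sets reals.

Set Implicit Arguments.
Unset Strict Implicit.
Unset Printing Implicit Defensive.

Import Order.TTheory.

Local Open Scope classical_set_scope.

(** Both border games are selections, so a strong core vector is efficient for both, forcing the two
    ends of [w] at the grand coalition to agree. Conversely, among selections the upper border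
    imposes the tightest coalition constraints; once the total is fixed, its core lies in that of
    every selection ([core_antimono]). *)

Lemma lower_empty (R : realType) (n : nat) (w : interval_game R n) :
  lower (w finset.set0) = 0%R.
Proof. by rewrite ivalue_empty. Qed.

Definition lower_border (R : realType) (n : nat) (w : interval_game R n) :
    game R n :=
  @Game R n (fun S => lower (w S)) (lower_empty w).

Lemma selectionP (R : realType) (n : nat) (w : interval_game R n)
    (v : game R n) :
  selection w v <-> forall S, (lower (w S) <= v S <= upper (w S))%R.
Proof. by split=> h S; move: (h S); rewrite /itv_of in_itv. Qed.

Lemma lower_border_selection (R : realType) (n : nat) (w : interval_game R n) :
  selection w (lower_border w).
Proof. by apply/selectionP => S /=; rewrite lexx lower_le_upper. Qed.

Lemma upper_border_selection (R : realType) (n : nat) (w : interval_game R n) :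
  selection w (upper_border w).
Proof. by apply/selectionP => S /=; rewrite lexx lower_le_upper. Qed.

(* The core constraints are lower bounds on coalition payoffs, so they only
   weaken when the game decreases with the grand coalition's value fixed. *)
Lemma core_antimono (R : realType) (n : nat) (u v : game R n) :
  v finset.setT = u finset.setT -> (forall S, v S <= u S)%R ->
  core u `<=` core v.
Proof.
move=> vuT le_vu x [[sumx ge1] geS]; split; first split.
- by rewrite sumx.
- by move=> i; apply: le_trans (ge1 i).
- by move=> S; apply: le_trans (geS S).
Qed.

Theorem theorem12 (R : realType) (n : nat) (w : interval_game R n) :
  strong_core w !=set0 <->
  degenerate (w finset.setT) /\ core (upper_border w) !=set0.
Proof.
split=> [[x scx]|[degT [x cx]]].
- have [[sum_lower _] _] := scx _ (lower_border_selection w).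
  have cux := scx _ (upper_border_selection w).
  have [[sum_upper _] _] := cux.
  split; last by exists x.
  (* The payoff total of [x] equals both ends of the interval of the grand coalition. *)
  exact: etrans (esym sum_lower) sum_upper.
- exists x => v /selectionP sel_v.
  apply: core_antimono cx => [|S]; last by case/andP: (sel_v S).
  (* Degeneracy squeezes [v] at the grand coalition between two equal bounds. *)
  by apply: le_anti; move: (sel_v finset.setT); rewrite degT andbC.
Qed.
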